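(* Let $(g,h,\omega)$ be a Born structure on a smooth manifold $M$ with recursion operators $A,B,J$. Then the $(\pm1)$-eigenbundles $L_\pm$ of $A$ are Lagrangian for $\omega$. In particular, $(\omega,L_+,L_-)$ is an almost Künneth structure. The pseudo-Riemannian metric $g$ of the Born structure is the neutral metric associated with this almost Künneth structure.
   Context: A Born structure on a smooth manifold $M$ is a triple $(g,h,\omega)$ where $g,h$ are pseudo-Riemannian metrics (of any signature) and $\omega$ is a non-degenerate 2-form such that the endomorphism fields $A,B,J$ of $TM$ (the recursion operators) determined by $g(AX,Y)=\omega(X,Y)$, $g(BX,Y)=h(X,Y)$, $\omega(-JX,Y)=h(X,Y)$ satisfy $A^2=B^2=-J^2=\mathrm{Id}$. An almost Künneth structure on $M$ consists of a non-degenerate 2-form $\omega$ together with two complementary $\omega$-isotropic subbundles $F,G$ of $TM$. Its almost product structure is $I(X_F+X_G)=X_F-X_G$, and its associated neutral metric is $(X,Y)\mapsto\omega(IX,Y)$; since the roles of $F$ and $G$ may be exchanged, $I$ and the neutral metric are defined only up to an overall sign (for $F=L_+$, $G=L_-$ one has $I=A$). *)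

(* Defs.v *)
From HB Require Import structures.
From mathcomp Require Import all_boot all_order all_algebra.
From mathcomp Require Import all_classical all_reals all_analysis.
Set Implicit Arguments.
Unset Strict Implicit.
Unset Printing Implicit Defensive.
Import Order.TTheory GRing.Theory Num.Theory.
Import numFieldNormedType.Exports.
Local Open Scope classical_set_scope.
Local Open Scope ring_scope.

(* [U] is meant to be open; [f] is arbitrary outside [U]. Since ['d f x v] is
   ['D_v f x], this is the usual notion of class C^k on finite-dimensional
   spaces. *)
Fixpoint Ck_on (R : realType) (V W : normedModType R) (k : nat) (U : set V)
    (f : V -> W) : Prop :=
  if k is k'.+1 then
    (forall x, U x -> differentiable f x) /\
    (forall v, Ck_on k' U (fun x => 'D_v f x))
  else forall x, U x -> {for x, continuous f}.

Definition smooth_on (R : realType) (V W : normedModType R) (U : set V)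
    (f : V -> W) : Prop := forall k, Ck_on k U f.

(* [chart_map] and [chart_inv] are total functions with arbitrary values outside
   [chart_dom] and [chart_map @` chart_dom] respectively. *)
Record chart (R : realType) (m : nat) (M : topologicalType) := Chart {
  chart_dom : set M ;
  chart_map :> M -> 'rV[R]_m ;
  chart_inv : 'rV[R]_m -> M ;
  chart_open_dom : open chart_dom ;
  chart_open_img : open (chart_map @` chart_dom) ;
  chart_mapK : forall p, chart_dom p -> chart_inv (chart_map p) = p ;
  chart_map_continuous :
    forall p, chart_dom p -> {for p, continuous chart_map} ;
  chart_inv_continuous :
    forall p, chart_dom p -> {for chart_map p, continuous chart_inv}
}.

(* The choice [chart_at] of a chart around each point carries no mathematical
   content: it is only used to represent tangent vectors. *)
Record smoothManifold (R : realType) (m : nat) := SmoothManifold {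
  mfd_carrier :> topologicalType ;
  mfd_hausdorff : hausdorff_space mfd_carrier ;
  mfd_second_countable : @second_countable mfd_carrier ;
  atlas : set (chart R m mfd_carrier) ;
  chart_at : mfd_carrier -> chart R m mfd_carrier ;
  atlas_chart_at : forall p, atlas (chart_at p) ;
  chart_at_dom : forall p, chart_dom (chart_at p) p ;
  transition_smooth : forall c d, atlas c -> atlas d ->
    smooth_on (c @` (chart_dom c `&` chart_dom d)) (d \o chart_inv c)
}.

(* A tangent vector at [p] is given by its coordinates in the chart
   [chart_at p]; [tangent_coord] and [tangent_of] below convert from and to
   coordinates in another chart, by the derivative of the transition map. *)
Definition tangent (R : realType) (m : nat) (M : smoothManifold R m) (p : M) :
  Type := 'rV[R]_m.

Definition tangent_coord (R : realType) (m : nat) (M : smoothManifold R m)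
    (c : chart R m M) (p : M) (X : tangent p) : 'rV[R]_m :=
  'd (c \o chart_inv (chart_at p)) (chart_at p p) X.

Definition tangent_of (R : realType) (m : nat) (M : smoothManifold R m)
    (c : chart R m M) (x u : 'rV[R]_m) : tangent (chart_inv c x : M) :=
  'd (chart_at (chart_inv c x : M) \o chart_inv c) x u.

Definition smooth_vector_field_on (R : realType) (m : nat)
    (M : smoothManifold R m) (W : set M) (X : forall p : M, tangent p) : Prop :=
  forall c : chart R m M, atlas c ->
    smooth_on (c @` (chart_dom c `&` W))
      (fun x => tangent_coord c (X (chart_inv c x))).

(* Smoothness of a (0,2)-tensor field: smoothness of its components in the
   charts of the atlas. *)
Definition smooth_form (R : realType) (m : nat) (M : smoothManifold R m)
    (t : forall p : M, tangent p -> tangent p -> R) : Prop :=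
  forall c : chart R m M, atlas c -> forall u v : 'rV[R]_m,
    smooth_on (c @` chart_dom c)
      (fun x => t (chart_inv c x) (tangent_of c x u) (tangent_of c x v)).

Definition pseudo_riemannian (R : realType) (m : nat) (M : smoothManifold R m)
    (g : forall p : M, {symmetric (tangent p)}) : Prop :=
  smooth_form g /\ forall p, nondegenerate (g p).

(* Over a real field, skew-symmetric and alternating forms coincide. *)
Definition nondegenerate_2form (R : realType) (m : nat)
    (M : smoothManifold R m) (w : forall p : M, {skew_symmetric (tangent p)}) :
    Prop :=
  smooth_form w /\ forall p, nondegenerate (w p).

Definition subbundle (R : realType) (m : nat) (M : smoothManifold R m)
    (F : forall p : M, {vspace tangent p}) : Prop :=
  exists k : nat, forall p : M,
    exists (W : set M) (X : 'I_k -> forall q : M, tangent q),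
      [/\ open W, W p,
          forall i, smooth_vector_field_on W (X i) &
          forall q, W q -> basis_of (F q) [seq X i q | i : 'I_k]].

(* [A], [B], [J] are not assumed smooth: this follows from the equations, the
   forms being smooth and non-degenerate. *)
Record recursion_operators (R : realType) (m : nat) (M : smoothManifold R m)
    (g h : forall p : M, {symmetric (tangent p)})
    (w : forall p : M, {skew_symmetric (tangent p)})
    (A B J : forall p : M, 'End(tangent p)) : Prop := RecursionOperators {
  recursion_A : forall p (X Y : tangent p), g p (A p X) Y = w p X Y ;
  recursion_B : forall p (X Y : tangent p), g p (B p X) Y = h p X Y ;
  recursion_J : forall p (X Y : tangent p), w p (- J p X) Y = h p X Y
}.

Record born_structure (R : realType) (m : nat) (M : smoothManifold R m)
    (g h : forall p : M, {symmetric (tangent p)})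
    (w : forall p : M, {skew_symmetric (tangent p)}) : Prop := BornStructure {
  born_g : pseudo_riemannian g ;
  born_h : pseudo_riemannian h ;
  born_w : nondegenerate_2form w ;
  born_recursion : exists A B J : forall p : M, 'End(tangent p),
    recursion_operators g h w A B J /\
    forall p, [/\ (A p \o A p = \1)%VF, (B p \o B p = \1)%VF &
                  (- (J p \o J p) = \1)%VF]
}.

Definition eigenbundle (R : realType) (m : nat) (M : smoothManifold R m)
    (A : forall p : M, 'End(tangent p)) (a : R) (p : M) :
    {vspace tangent p} := passmx.leigenspace (A p) a.

Definition isotropic (R : realType) (m : nat) (M : smoothManifold R m)
    (w : forall p : M, {skew_symmetric (tangent p)})
    (L : forall p : M, {vspace tangent p}) : Prop :=
  forall p, (L p <= orthov (w p) (L p))%VS.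

Definition lagrangian (R : realType) (m : nat) (M : smoothManifold R m)
    (w : forall p : M, {skew_symmetric (tangent p)})
    (L : forall p : M, {vspace tangent p}) : Prop :=
  subbundle L /\ forall p, orthov (w p) (L p) = L p.

Record almost_kunneth (R : realType) (m : nat) (M : smoothManifold R m)
    (w : forall p : M, {skew_symmetric (tangent p)})
    (F G : forall p : M, {vspace tangent p}) : Prop := AlmostKunneth {
  kunneth_w : nondegenerate_2form w ;
  kunneth_F : subbundle F ;
  kunneth_G : subbundle G ;
  kunneth_complementary :
    forall p, (F p + G p)%VS = fullv /\ (F p :&: G p)%VS = 0%VS ;
  kunneth_isotropic_F : isotropic w F ;
  kunneth_isotropic_G : isotropic w G
}.

Definition almost_product (R : realType) (m : nat) (M : smoothManifold R m)
    (F G : forall p : M, {vspace tangent p}) (p : M) : 'End(tangent p) :=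
  daddv_pi (F p) (G p) - daddv_pi (G p) (F p).

Lemma almost_productE (R : realType) (m : nat) (M : smoothManifold R m)
    (F G : forall p : M, {vspace tangent p}) (p : M) (X Y : tangent p) :
  (F p :&: G p)%VS = 0%VS -> X \in F p -> Y \in G p ->
  almost_product F G p (X + Y) = X - Y.
Proof.
move=> FG XF YG; have GF : (G p :&: F p)%VS = 0%VS by rewrite capvC.
have := daddv_pi_add FG (memv_add XF YG).
rewrite /almost_product add_lfunE opp_lfunE => e.
have eF : daddv_pi (F p) (G p) (X + Y) = X.
  have u := @directv_add_unique _ _ (F p) (G p).
  have /u{}u : directv (F p + G p) by apply/directv_addP.
  have := u _ _ _ _ (memv_pi (F p) (G p) (X + Y)) XF
                    (memv_pi (G p) (F p) (X + Y)) YG.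
  by rewrite e eqxx => /esym/andP[/eqP].
by move: e; rewrite eF => /addrI ->.
Qed.

(* The ordered pair [(F, G)] fixes the sign of the almost product structure and
   of the neutral metric: both change sign when [F] and [G] are exchanged. *)
Definition neutral_metric (R : realType) (m : nat) (M : smoothManifold R m)
    (w : forall p : M, {skew_symmetric (tangent p)})
    (F G : forall p : M, {vspace tangent p}) (p : M) (X Y : tangent p) : R :=
  w p (almost_product F G p X) Y.

(* Main.v *)
Require Import Defs.
From HB Require Import structures.
From mathcomp Require Import all_boot all_order all_algebra.
From mathcomp Require Import all_classical all_reals all_analysis.
Set Implicit Arguments.
Unset Strict Implicit.
Unset Printing Implicit Defensive.
Import Order.TTheory GRing.Theory Num.Theory.
Import numFieldNormedType.Exports.
Local Open Scope ring_scope.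

(** At each point the statement is linear algebra. As [g] is symmetric and [w]
    is skew, on an eigenspace of [A] the form [w X Y = g (A X) Y] is a multiple
    of [g], hence both symmetric and skew, hence zero: the eigenspaces are
    isotropic. Since [A] is an involution, every vector splits into its
    eigencomponents, and a vector orthogonal to one eigenspace for [w] has a
    component in the other eigenspace that is orthogonal to everything, so it
    vanishes: [orthov_eigenspace]. The almost product structure of the pair of
    eigenbundles is [A] itself, and [w (A X) Y = g (A (A X)) Y = g X Y].

    What remains is that the eigenbundles are smooth subbundles of constant
    rank. Constant rank is not automatic, because the manifold may be
    disconnected; it comes from the Lagrangian property, which makes the two
    eigenspaces have equal dimension ([dim_eigenspace]).

    For the frames ([eigenbundle_subbundle]), let [G] and [O] be the Gram
    matrices of [g] and [w] in the frame of a chart, with vectors written as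
    rows. Then [A] has matrix [O G^-1], and [det G (1 + a O G^-1)] equals
    [det G + a O adj G], which is polynomial in the smooth entries of [G] and
    [O], so that the smoothness of an inverse never has to be discussed. For
    [a = 1] or [a = -1] this matrix is, up to an invertible scalar, the
    projection onto the [a]-eigenspace. Applied to the constant extension of a
    basis of the eigenspace at a point, it yields smooth sections of the
    eigenbundle. They form a basis where a certain determinant is nonzero,
    which holds near the point by continuity. To see that these fields are
    smooth in every chart of the atlas, one needs the chain rule for the
    transition maps and the stability of the C^k classes under sums, products
    and composition. *)

(** * Calculus of C^k functions *)

(** Only the existence of a first-order expansion at [x] is at stake, and the
    expansion of [f] is one for [g]. *)
Lemma near_eq_differentiable (R : realType) (V W : normedModType R)
    (f g : V -> W) (x : V) :
  (\forall y \near x, f y = g y) -> differentiable f x -> differentiable g x.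
Proof.
move=> fg df; have dfc := diff_continuous df.
have gE : g \o shift x = cst (g x) + 'd f x +o_ 0 id.
  have /eqaddoP fE := diff_locally df.
  apply/eqaddoP => e e0; have := fE e e0.
  have fg0 : \forall h \near (0 : V), f (h + x) = g (h + x).
    move: fg; rewrite (near_shift 0 x).
    by apply: filterS => h /=; rewrite subr0.
  by apply: filterS2 fg0 => h /=; rewrite !fctE /= -(nbhs_singleton fg) => ->.
by apply/diff_locallyP; rewrite (diff_unique dfc gE).
Qed.

(** Openness of [U] is what makes directional derivatives on [U] depend only on
    the values on [U]. *)
Lemma Ck_on_eq (R : realType) (V W : normedModType R) (k : nat) (U : set V)
    (f g : V -> W) :
  open U -> (forall x, U x -> f x = g x) -> Ck_on k U f -> Ck_on k U g.
Proof.
move=> oU; have nU x : U x -> \forall y \near x, U y.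
  by move=> Ux; apply: open_nbhs_nbhs; split.
elim: k f g => [|k IH] f g fg /= => [fC x Ux|[fD fC]].
  have nfg : {near x, f =1 g} by apply: filterS (nU _ Ux) => y /fg.
  have := fC x Ux; rewrite /prop_for /continuous_at (fg x Ux).
  by apply: cvg_trans; apply: near_eq_cvg.
have nfg x : U x -> {near x, f =1 g} by move=> /nU; apply: filterS => y /fg.
split=> [x Ux|v]; first exact: near_eq_differentiable (nfg _ Ux) (fD x Ux).
by apply: IH (fC v) => x Ux; apply: near_eq_derive; apply: nfg.
Qed.

Lemma Ck_onW (R : realType) (V W : normedModType R) (k : nat) (U : set V)
    (f : V -> W) : Ck_on k.+1 U f -> Ck_on k U f.
Proof.
elim: k f => [|k IH] f [fD fC].
  by move=> x /fD /differentiable_continuous.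
by split=> // v; apply: IH.
Qed.

Lemma Ck_on_subset (R : realType) (V W : normedModType R) (k : nat)
    (U U' : set V) (f : V -> W) :
  (U' `<=` U)%classic -> Ck_on k U f -> Ck_on k U' f.
Proof.
move=> sU; elim: k f => [|k IH] f /= => [fC x /sU|[fD fC]]; first exact: fC.
by split=> [x /sU|v]; [apply: fD|apply: IH].
Qed.

Lemma Ck_on_cst (R : realType) (V W : normedModType R) (k : nat) (U : set V)
    (a : W) : Ck_on k U (fun _ : V => a).
Proof.
elim: k a => [|k IH] a /=; first by move=> x _; apply: cvg_cst.
split=> [x _|v]; first exact: differentiable_cst.
have -> : (fun x => 'D_v (fun _ : V => a) x) = (fun _ => 0); last exact: IH.
by apply/funext => x; rewrite derive_cst.
Qed.

Lemma Ck_onD (R : realType) (V W : normedModType R) (k : nat) (U : set V)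
    (f g : V -> W) :
  open U -> Ck_on k U f -> Ck_on k U g -> Ck_on k U (fun x => f x + g x).
Proof.
move=> oU; elim: k f g => [|k IH] f g /=.
  by move=> fC gC x Ux; apply: continuousD; [apply: fC|apply: gC].
move=> [fD fC] [gD gC]; split=> [x Ux|v].
  by apply: differentiableD; [apply: fD|apply: gD].
apply: Ck_on_eq oU _ (IH _ _ (fC v) (gC v)) => x Ux.
by rewrite -deriveD//; apply: diff_derivable; [apply: fD|apply: gD].
Qed.

Lemma Ck_on_sum (R : realType) (V W : normedModType R) (k : nat) (U : set V)
    (I : Type) (r : seq I) (P : pred I) (f : I -> V -> W) :
  open U -> (forall i, P i -> Ck_on k U (f i)) ->
  Ck_on k U (fun x => \sum_(i <- r | P i) f i x).
Proof.
move=> oU fC; elim: r => [|i r IH].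
  by under eq_fun do rewrite big_nil; apply: Ck_on_cst.
under eq_fun do rewrite big_cons.
by case: (P i) (fC i) => // /(_ isT) fiC; apply: Ck_onD.
Qed.

(** A continuous linear map commutes with directional derivatives. *)
Lemma Ck_on_linear (R : realType) (V W W' : normedModType R) (k : nat)
    (U : set V) (l : {linear W -> W'}) (f : V -> W) :
  open U -> continuous l -> Ck_on k U f -> Ck_on k U (fun x => l (f x)).
Proof.
move=> oU lC; have lD y : differentiable l y by apply: linear_differentiable.
elim: k f => [|k IH] f /=.
  by move=> fC x Ux; apply: continuous_comp; [apply: fC|apply: lC].
move=> [fD fC]; split=> [x Ux|v].
  by apply: differentiable_comp => //; apply: fD.
apply: Ck_on_eq oU _ (IH _ (fC v)) => x Ux.
have fDx := fD x Ux; have lfD : differentiable (l \o f) x.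
  exact: differentiable_comp.
rewrite (deriveE _ lfD) deriveE// (diff_comp fDx (lD _)) /=.
exact: (congr1 (@^~ ('d f x v)) (esym (diff_lin (f x) lC))).
Qed.

(** The product rule involves [f] and [g] next to their derivatives, so the
    induction needs them at the lower order too, whence [Ck_onW]. *)
Lemma Ck_onM (R : realType) (V : normedModType R) (k : nat) (U : set V)
    (f g : V -> R) :
  open U -> Ck_on k U f -> Ck_on k U g -> Ck_on k U (fun x => f x * g x).
Proof.
move=> oU; elim: k f g => [|k IH] f g.
  by move=> fC gC x Ux; apply: continuousM; [apply: fC|apply: gC].
move=> fk gk; have [[fD fC] [gD gC]] := (fk, gk); split=> [x Ux|v].
  by apply: differentiableM; [apply: fD|apply: gD].
apply: Ck_on_eq oU _ (Ck_onD oU (IH _ _ (Ck_onW fk) (gC v))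
                                (IH _ _ (Ck_onW gk) (fC v))) => x Ux.
by rewrite deriveM//; apply: diff_derivable; [apply: fD|apply: gD].
Qed.

Lemma Ck_on_prod (R : realType) (V : normedModType R) (k : nat) (U : set V)
    (I : Type) (r : seq I) (P : pred I) (f : I -> V -> R) :
  open U -> (forall i, P i -> Ck_on k U (f i)) ->
  Ck_on k U (fun x => \prod_(i <- r | P i) f i x).
Proof.
move=> oU fC; elim: r => [|i r IH].
  by under eq_fun do rewrite big_nil; apply: Ck_on_cst.
under eq_fun do rewrite big_cons.
by case: (P i) (fC i) => // /(_ isT) fiC; apply: Ck_onM.
Qed.

Lemma Ck_on_coord (R : realType) (V : normedModType R) (k m n : nat)
    (U : set V) (f : V -> 'M[R]_(m, n)) i j :
  open U -> Ck_on k U f -> Ck_on k U (fun x => f x i j).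
Proof.
move=> oU fC.
have lP : linear (fun M : 'M[R]_(m, n) => M i j : R^o).
  by move=> a M N; rewrite !mxE.
pose lM := GRing.isLinear.Build _ _ _ _ _ lP.
pose l : {linear 'M[R]_(m, n) -> R^o} :=
  HB.pack (fun M : 'M[R]_(m, n) => M i j) lM.
exact: (@Ck_on_linear _ _ _ _ _ _ l _ oU (@coord_continuous _ _ _ _ _)).
Qed.

(** A row vector is a combination of constant vectors with its entries as
    coefficients; this reduces vector-valued smoothness to scalar functions,
    for which products are available. *)
Lemma Ck_on_row (R : realType) (V : normedModType R) (k n : nat) (U : set V)
    (f : V -> 'rV[R]_n) :
  open U -> (forall j, Ck_on k U (fun x => f x 0 j)) -> Ck_on k U f.
Proof.
move=> oU fC.
have -> : f = fun x => \sum_j f x 0 j *: delta_mx 0 j.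
  by apply/funext => x; rewrite {1}(row_sum_delta (f x)).
apply: Ck_on_sum => // j _.
have lP : linear (fun a : R^o => a *: delta_mx 0 j : 'rV[R]_n).
  by move=> a b c; rewrite scalerDl scalerA.
pose lM := GRing.isLinear.Build _ _ _ _ _ lP.
pose l : {linear R^o -> 'rV[R]_n} :=
  HB.pack (fun a : R^o => a *: delta_mx 0 j) lM.
exact: (@Ck_on_linear _ _ _ _ _ _ l _ oU (@scalel_continuous _ _ _)).
Qed.

Lemma derive_rowE (R : realType) (W : normedModType R) (m : nat)
    (f : 'rV[R]_m -> W) (x v : 'rV[R]_m) : differentiable f x ->
  'D_v f x = \sum_j v 0 j *: 'D_(delta_mx 0 j) f x.
Proof.
move=> fD; rewrite deriveE// {1}(row_sum_delta v) linear_sum.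
by apply: eq_bigr => j _; rewrite linearZ deriveE.
Qed.

(** By the chain rule, a directional derivative of [f \o s] is a sum of products
    of entries of the derivative of [s] and of partial derivatives of [f]
    composed with [s]; the latter are covered by the induction hypothesis. *)
Lemma Ck_on_comp (R : realType) (V : normedModType R) (k m : nat)
    (U : set V) (U' : set 'rV[R]_m) (s : V -> 'rV[R]_m) (f : 'rV[R]_m -> R) :
  open U -> (forall x, U x -> U' (s x)) -> Ck_on k U s -> Ck_on k U' f ->
  Ck_on k U (fun x => f (s x)).
Proof.
move=> oU sU; elim: k f => [|k IH] f.
  move=> sC fC x Ux.
  by apply: continuous_comp; [apply: sC|apply: fC; apply: sU].
move=> sk [fD fC]; have [sD sC] := sk; split=> [x Ux|v].
  by apply: differentiable_comp; [apply: sD|apply: fD; apply: sU].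
pose D x := \sum_j 'D_v s x 0 j * 'D_(delta_mx 0 j) f (s x).
apply: (@Ck_on_eq _ _ _ _ _ D _ oU) => [x Ux|].
  have sDx := sD x Ux; have fDx := fD _ (sU x Ux).
  have fsD : differentiable (f \o s) x by exact: differentiable_comp.
  have <- : 'D_('D_v s x) f (s x) = D x by exact: derive_rowE fDx.
  rewrite (deriveE _ fsD) (diff_comp sDx fDx).
  by rewrite (deriveE _ fDx) (deriveE _ sDx).
apply: Ck_on_sum => // j _; apply: Ck_onM => //.
  exact: Ck_on_coord oU (sC v).
exact: IH (Ck_onW sk) (fC (delta_mx 0 j)).
Qed.

Section MatrixSmoothness.
Variables (R : realType) (V : normedModType R) (k : nat) (U : set V).
Hypothesis oU : open U.

Lemma Ck_on_det n (N : V -> 'M[R]_n) :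
  (forall i j, Ck_on k U (fun x => N x i j)) -> Ck_on k U (fun x => \det (N x)).
Proof.
move=> NC; apply: Ck_on_sum => // s _; apply: Ck_onM => //.
  exact: Ck_on_cst.
by apply: Ck_on_prod.
Qed.

Lemma Ck_on_mulmx n1 n2 n3 (N : V -> 'M[R]_(n1, n2)) (P : V -> 'M[R]_(n2, n3)) :
  (forall i j, Ck_on k U (fun x => N x i j)) ->
  (forall i j, Ck_on k U (fun x => P x i j)) ->
  forall i j, Ck_on k U (fun x => (N x *m P x) i j).
Proof.
move=> NC PC i j; under eq_fun do rewrite mxE.
by apply: Ck_on_sum => // l _; apply: Ck_onM.
Qed.

Lemma Ck_on_adj n (N : V -> 'M[R]_n) :
  (forall i j, Ck_on k U (fun x => N x i j)) ->
  forall i j, Ck_on k U (fun x => (\adj (N x)) i j).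
Proof.
move=> NC i j; under eq_fun do rewrite mxE.
apply: Ck_onM => //; first exact: Ck_on_cst.
by apply: Ck_on_det => i' j'; under eq_fun do rewrite !mxE.
Qed.

End MatrixSmoothness.

(** * Linear algebra in one tangent space *)

Lemma symmetric_formC (R : realFieldType) (vT : lmodType R)
    (g : {symmetric vT}) (X Y : vT) : g X Y = g Y X.
Proof. by rewrite hermC expr0 mul1r. Qed.

Lemma skew_formC (R : realFieldType) (vT : lmodType R)
    (w : {skew_symmetric vT}) (X Y : vT) : w X Y = - w Y X.
Proof. by rewrite hermC expr1 mulN1r. Qed.

Lemma nondegenerate_eq0 (R : realFieldType) (vT : vectType R) (eps : bool)
    (f : {hermitian vT for eps & idfun}) (X : vT) :
  nondegenerate f -> (forall Y, f X Y = 0) -> X = 0.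
Proof.
move=> /eqP f0 X0; apply/eqP; rewrite -memv0 -f0.
by apply/mem_orthovP => Y _.
Qed.

(** Pairing with a basis of [U] is a linear map from [V] to a space of dimension
    [\dim U] whose kernel is the part of [V] orthogonal to [U]. *)
Lemma dim_cap_orthov (R : realFieldType) (vT : vectType R) (eps : bool)
    (f : {hermitian vT for eps & idfun}) (U V : {vspace vT}) :
  (\dim V <= \dim (V :&: orthov f U) + \dim U)%N.
Proof.
pose phi (X : vT) : 'rV[R]_(\dim U) := \row_i f X (vbasis U)`_i.
have phiL : linear phi.
  by move=> a X Y; apply/rowP => i; rewrite !mxE linearDl linearZl.
pose phiM := GRing.isLinear.Build _ _ _ _ _ phiL.
pose phi' : {linear vT -> 'rV[R]_(\dim U)} := HB.pack phi phiM.
rewrite -(limg_ker_dim (linfun phi') V) leq_add//.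
  apply/dimvS/subvP => X; rewrite !memv_cap memv_ker lfunE /= => /andP[-> /=].
  move=> /eqP/rowP phiX0; apply/mem_orthovP => Y /coord_vbasis->.
  rewrite linear_sumr big1// => i _.
  by have := phiX0 i; rewrite !mxE linearZr /= => ->; rewrite mulr0.
by rewrite (leq_trans (dimvS (subvf _)))// dimvf /dim /= mul1n.
Qed.

Lemma mem_leigenspace (R : realFieldType) (vT : vectType R) (f : 'End(vT))
    (a : R) (X : vT) : (X \in passmx.leigenspace f a) = (f X == a *: X).
Proof.
by rewrite memv_ker add_lfunE opp_lfunE scale_lfunE id_lfunE subr_eq0.
Qed.

Section Involution.
Variables (R : realFieldType) (vT : vectType R) (A : 'End(vT)).
Hypothesis AA : forall X, A (A X) = X.
Local Notation L := (passmx.leigenspace A).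

Definition eigenproj (a : R) (X : vT) : vT := 2^-1 *: (X + a *: A X).

(** Applying [A] exchanges the two terms up to the factor [a]. The factor [b] is
    for the frames, where the projection occurs multiplied by a determinant. *)
Lemma mem_eigenproj_scaled (a b : R) (X : vT) :
  a * a = 1 -> b *: (X + a *: A X) \in L a.
Proof.
move=> aa; rewrite mem_leigenspace linearZ linearD linearZ /= AA.
rewrite [X in _ == X]scalerA [a * b]mulrC -scalerA [a *: (_ + _)]scalerDr.
by rewrite [a *: (a *: _)]scalerA aa scale1r addrC.
Qed.

Lemma mem_eigenproj (a : R) (X : vT) : a * a = 1 -> eigenproj a X \in L a.
Proof. exact: mem_eigenproj_scaled. Qed.

Lemma eigenprojD (a : R) (X : vT) : eigenproj a X + eigenproj (- a) X = X.
Proof.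
rewrite /eigenproj -scalerDr addrACA scaleNr subrr addr0 -mulr2n.
rewrite -[X *+ 2]scaler_nat scalerA.
by rewrite mulVf ?scale1r// pnatr_eq0.
Qed.

Lemma eigenspace_cap : (L 1 :&: L (- 1) = 0)%VS.
Proof.
apply/eqP; rewrite -subv0; apply/subvP => X; rewrite memv_cap !mem_leigenspace.
rewrite scale1r scaleN1r memv0 => /andP[/eqP-> ].
by rewrite -subr_eq0 opprK -mulr2n -scaler_nat scaler_eq0 pnatr_eq0.
Qed.

Lemma eigenspace_add : (L 1 + L (- 1) = fullv)%VS.
Proof.
apply/eqP; rewrite eqEsubv subvf; apply/subvP => X _.
by rewrite -(eigenprojD 1 X) memv_add// mem_eigenproj// ?mulrNN mulr1.
Qed.

Variables (g : {symmetric vT}) (w : {skew_symmetric vT}).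
Hypothesis gA : forall X Y, g (A X) Y = w X Y.

(** There [w] is [a] times [g], hence symmetric as well as skew. *)
Lemma eigenspace_isotropic (a : R) : (L a <= orthov w (L a))%VS.
Proof.
apply/orthovP => X Y; rewrite !mem_leigenspace => /eqP AX /eqP AY.
have wE : w X Y = w Y X.
  by rewrite -!gA AX AY !linearZl /= symmetric_formC.
have /eqP := skew_formC w X Y.
by rewrite -wE -subr_eq0 opprK -mulr2n mulrn_eq0 => /eqP.
Qed.

Hypothesis wN : nondegenerate w.

(** If [X] is orthogonal to the [a]-eigenspace, so is its component in the
    opposite eigenspace, by isotropy of the former. That component is also
    orthogonal to the opposite eigenspace, by isotropy of the latter, so it is
    in the radical of [w]. *)
Lemma orthov_eigenspace (a : R) : a * a = 1 -> orthov w (L a) = L a.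
Proof.
move=> aa; apply/eqP; rewrite eqEsubv eigenspace_isotropic andbT.
have Naa : - a * - a = 1 by rewrite mulrNN.
apply/subvP => X /mem_orthovP X0; rewrite -(eigenprojD a X).
suff -> : eigenproj (- a) X = 0 by rewrite addr0 mem_eigenproj.
apply: (nondegenerate_eq0 wN) => Y.
have iso b U V : b * b = 1 -> w (eigenproj b U) (eigenproj b V) = 0.
  by move=> bb; apply: (orthovP (eigenspace_isotropic b)); apply: mem_eigenproj.
rewrite -(eigenprojD a Y) linearDr /= [X in _ + X]iso// addr0.
have -> : eigenproj (- a) X = X - eigenproj a X.
  by rewrite -{2}(eigenprojD a X) addrC addKr.
by rewrite linearBl /= iso// X0 ?subr0// mem_eigenproj.
Qed.

(** Each eigenspace meets the orthogonal of the other in zero, so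
    [dim_cap_orthov] bounds the dimension of each by that of the other. *)
Lemma dim_eigenspace (a : R) :
  a = 1 \/ a = - 1 -> \dim (L a) = (\dim {:vT})./2.
Proof.
have le_dim b : b * b = 1 -> (\dim (L b) <= \dim (L (- b)))%N.
  move=> bb; have := dim_cap_orthov w (L (- b)) (L b).
  rewrite orthov_eigenspace ?mulrNN//.
  suff -> : (L b :&: L (- b) = 0)%VS by rewrite dimv0.
  have [->|->] : b = 1 \/ b = - 1.
  - by move/eqP: bb; rewrite -expr2 sqrf_eq1 => /orP[/eqP|/eqP]; [left|right].
  - exact: eigenspace_cap.
  - by rewrite opprK capvC eigenspace_cap.
have dimE : \dim (L (- 1)) = \dim (L 1).
  apply/eqP; rewrite eqn_leq le_dim ?mulr1// -{2}[1]opprK.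
  by have := le_dim (- 1); rewrite opprK mulrNN mulr1 => ->.
have := dimv_disjoint_sum eigenspace_cap; rewrite eigenspace_add dimE => dT.
by rewrite dT addnn doubleK => -[] ->.
Qed.

End Involution.

(** * Gram matrices and the eigenprojections *)

Section GramMatrix.
Variables (R : realFieldType) (m : nat) (vT : vectType R).
Variable F : {linear 'rV[R]_m -> vT}.

Definition gram_matrix (eps : bool) (f : {hermitian vT for eps & idfun}) :
    'M[R]_m :=
  \matrix_(i, j) f (F (delta_mx 0 i)) (F (delta_mx 0 j)).

Lemma gram_matrixE (eps : bool) (f : {hermitian vT for eps & idfun})
    (u v : 'rV[R]_m) : f (F u) (F v) = (u *m gram_matrix f *m v^T) 0 0.
Proof.
have FE x : F x = \sum_i x 0 i *: F (delta_mx 0 i).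
  rewrite {1}(row_sum_delta x) linear_sum.
  by apply: eq_bigr => i _; rewrite linearZ.
rewrite (FE u) (FE v) linear_sumr mxE; apply: eq_bigr => j _.
rewrite linear_sumlz !mxE mulr_suml; apply: eq_bigr => i _.
by rewrite !mxE linearZl linearZr /= mulrCA mulrC.
Qed.

Hypotheses (Finj : injective F) (Fsurj : forall X, exists u, F u = X).

(** A row in the kernel of the Gram matrix represents a vector of the radical
    of [f]. *)
Lemma det_gram_neq0 (eps : bool) (f : {hermitian vT for eps & idfun}) :
  nondegenerate f -> \det (gram_matrix f) != 0.
Proof.
move=> fN; rewrite -unitfE -unitmxE -row_free_unit -kermx_eq0.
apply/rowV0P => u /sub_kermxP u0; apply: Finj; rewrite linear0.
apply: (nondegenerate_eq0 fN) => Y; have [v <-] := Fsurj Y.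
by rewrite gram_matrixE u0 mul0mx mxE.
Qed.

Variables (g : {symmetric vT}) (w : {skew_symmetric vT}) (A : 'End(vT)).
Hypotheses (gA : forall X Y, g (A X) Y = w X Y) (gN : nondegenerate g).

(** The relation between [g], [w] and [A] says that the matrix of [A] times the
    Gram matrix of [g] is the Gram matrix of [w]; multiply by the adjugate. *)
Lemma gram_adjugateE (u : 'rV[R]_m) :
  F (u *m (gram_matrix w *m \adj (gram_matrix g))) =
  \det (gram_matrix g) *: A (F u).
Proof.
apply/subr0_eq/(nondegenerate_eq0 gN) => Y; have [v <-] := Fsurj Y.
rewrite linearBl linearZl /= gA !gram_matrixE mulmxA -!mulmxA.
rewrite [\adj _ *m _]mulmxA mul_adj_mx mul_scalar_mx.
by rewrite -!scalemxAr mxE subrr.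
Qed.

End GramMatrix.

(** This is [\det G] times [1 + a O G^-1], written without the inverse so that
    its entries are polynomials in those of [G] and [O]. *)
Definition scaled_eigenproj_mx (R : comNzRingType) (m : nat) (a : R)
    (G O : 'M[R]_m) : 'M[R]_m := \det G *: 1%:M + a *: (O *m \adj G).

Lemma scaled_eigenproj_mxE (R : realFieldType) (m : nat) (vT : vectType R)
    (F : {linear 'rV[R]_m -> vT}) (Fsurj : forall X, exists u, F u = X)
    (g : {symmetric vT}) (w : {skew_symmetric vT}) (A : 'End(vT)) (a : R)
    (u : 'rV[R]_m) :
  (forall X Y, g (A X) Y = w X Y) -> nondegenerate g ->
  F (u *m scaled_eigenproj_mx a (gram_matrix F g) (gram_matrix F w)) =
  \det (gram_matrix F g) *: (F u + a *: A (F u)).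
Proof.
move=> gA gN; rewrite /scaled_eigenproj_mx mulmxDr -!scalemxAr mulmx1.
rewrite linearD !linearZ /= (gram_adjugateE Fsurj gA gN) scalerDr.
by rewrite !scalerA mulrC.
Qed.

Lemma Ck_on_scaled_eigenproj_mx (R : realType) (V : normedModType R) (k : nat)
    (U : set V) (n : nat) (a : R) (G O : V -> 'M[R]_n) :
  open U ->
  (forall i j, Ck_on k U (fun x => G x i j)) ->
  (forall i j, Ck_on k U (fun x => O x i j)) ->
  forall i j, Ck_on k U (fun x => scaled_eigenproj_mx a (G x) (O x) i j).
Proof.
move=> oU GC OC i j; rewrite /scaled_eigenproj_mx.
have -> : (fun x => (\det (G x) *: 1%:M + a *: (O x *m \adj (G x))) i j) =
    (fun x => \det (G x) * (1%:M : 'M[R]_n) i j + a * (O x *m \adj (G x)) i j).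
  by apply/funext => x; rewrite mxE [X in X + _]mxE [X in _ + X]mxE.
apply: Ck_onD => //; apply: Ck_onM => //; try exact: Ck_on_cst.
  exact: Ck_on_det.
by apply: Ck_on_mulmx => //; apply: Ck_on_adj.
Qed.

(** * Charts and tangent vectors *)

Section Charts.
Variables (R : realType) (m : nat) (M : smoothManifold R m).
Implicit Types (c d e : chart R m M) (p : M).
Local Open Scope classical_set_scope.

(** On the image of the chart, membership in [c @` W] is membership of the
    preimage in [W], an open condition by continuity of the inverse chart. *)
Lemma open_chart_image c (W : set M) :
  open W -> open (c @` (chart_dom c `&` W)).
Proof.
move=> oW; rewrite openE => _ [p [cp Wp] <-].
have Nimg : \forall y \near c p, (c @` chart_dom c) y.
  by apply: open_nbhs_nbhs; split; [exact: chart_open_img|exists p].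
have NW : \forall y \near c p, W (chart_inv c y).
  apply: (chart_inv_continuous cp); rewrite chart_mapK//.
  by apply: open_nbhs_nbhs; split.
apply: filterS2 Nimg NW => y [q cq <-]; rewrite chart_mapK// => Wq.
by exists q.
Qed.

(** The derivative at [p] of the change of coordinates from [c] to [d]: it turns
    the components of a tangent vector in [c] into those in [d]. *)
Definition transition_diff c d p : {linear 'rV[R]_m -> 'rV[R]_m} :=
  'd (d \o chart_inv c) (c p).

Lemma differentiable_transition c d p : atlas c -> atlas d ->
  chart_dom c p -> chart_dom d p -> differentiable (d \o chart_inv c) (c p).
Proof.
move=> ac ad cp dp; have [+ _] := transition_smooth ac ad 1.
by apply; exists p.
Qed.

(** The cocycle identity of the tangent bundle, from the chain rule: near [c p]
    the transition from [c] to [e] factors through [d]. *)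
Lemma transition_diff_comp c d e p u : atlas c -> atlas d -> atlas e ->
  chart_dom c p -> chart_dom d p -> chart_dom e p ->
  transition_diff d e p (transition_diff c d p u) = transition_diff c e p u.
Proof.
move=> ac ad ae cp dp ep; rewrite /transition_diff.
have cdD := differentiable_transition ac ad cp dp.
have deD := differentiable_transition ad ae dp ep.
have ceD := differentiable_transition ac ae cp ep.
have dE : (d \o chart_inv c) (c p) = d p by rewrite /= chart_mapK.
rewrite -dE in deD *; rewrite -[RHS]deriveE//.
have cdeD : differentiable ((e \o chart_inv d) \o (d \o chart_inv c)) (c p).
  exact: differentiable_comp.
rewrite -[LHS]/(('d (e \o chart_inv d) _ \o 'd (d \o chart_inv c) (c p)) u).
rewrite -diff_comp// -deriveE//; apply: near_eq_derive.
have : \forall y \near c p, (c @` (chart_dom c `&` chart_dom d)) y.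
  apply: open_nbhs_nbhs; split; last by exists p.
  exact/open_chart_image/chart_open_dom.
by apply: filterS => y [q [cq dq] <-] /=; rewrite (chart_mapK cq) chart_mapK.
Qed.

Lemma transition_diff_id c p u : chart_dom c p -> transition_diff c c p u = u.
Proof.
move=> cp; rewrite /transition_diff.
have nE : \forall y \near c p, y = (c \o chart_inv c) y.
  have : \forall y \near c p, (c @` chart_dom c) y.
    by apply: open_nbhs_nbhs; split; [exact: chart_open_img|exists p].
  by apply: filterS => y [q cq <-] /=; rewrite chart_mapK.
have idD : differentiable (fun y : 'rV[R]_m => y) (c p).
  exact: (@ex_diff _ _ _ _ _ id id).
rewrite -deriveE; last exact: near_eq_differentiable nE idD.
by rewrite -(near_eq_derive _ nE) derive_id.
Qed.

Lemma transition_diffK c d p : atlas c -> atlas d ->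
  chart_dom c p -> chart_dom d p ->
  cancel (transition_diff c d p) (transition_diff d c p).
Proof.
by move=> *; move=> u; rewrite transition_diff_comp// transition_diff_id.
Qed.

(** The tangent vector at [p] with given components in [c]. For [p] in the
    domain of [c] it agrees with [tangent_of c (c p)], but its type mentions [p]
    and not [chart_inv c (c p)], which is equal to [p] only propositionally. *)
Definition chart_frame c p : {linear 'rV[R]_m -> tangent p} :=
  transition_diff c (chart_at p) p.

Lemma chart_frame_inj c p :
  atlas c -> chart_dom c p -> injective (chart_frame c p).
Proof.
move=> ac cp; apply: can_inj.
exact: transition_diffK ac (atlas_chart_at p) cp (chart_at_dom p).
Qed.

Lemma chart_frame_surj c p : atlas c -> chart_dom c p ->
  forall X, exists u, chart_frame c p u = X.
Proof.
move=> ac cp X; exists (transition_diff (chart_at p) c p X).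
exact: (transition_diffK (atlas_chart_at p) ac (chart_at_dom p) cp).
Qed.

Lemma tangent_coord_frame c d p u : atlas c -> atlas d ->
  chart_dom c p -> chart_dom d p ->
  tangent_coord d (chart_frame c p u : tangent p) = transition_diff c d p u.
Proof.
move=> ac ad cp dp.
exact: transition_diff_comp ac (atlas_chart_at p) ad cp (chart_at_dom p) dp.
Qed.

Definition chart_gram (t : forall p : M, tangent p -> tangent p -> R) c
    (x : 'rV[R]_m) : 'M[R]_m :=
  \matrix_(i, j) t (chart_inv c x) (tangent_of c x (delta_mx 0 i))
                                   (tangent_of c x (delta_mx 0 j)).

Lemma chart_gramE (eps : bool)
    (f : forall p : M, {hermitian (tangent p) for eps & idfun}) c p :
  chart_dom c p -> chart_gram f c (c p) = gram_matrix (chart_frame c p) (f p).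
Proof.
move=> cp; apply/matrixP => i j.
rewrite [LHS]mxE [RHS]mxE /tangent_of.
by move: (chart_inv c (c p)) (chart_mapK cp) => q ->.
Qed.

(** A vector field that is smooth in the chart [c] is smooth in [d]: its
    components in [d] are, by expanding in the canonical basis, sums of
    products of its components in [c] and partial derivatives of the transition
    map, composed with the transition from [d] to [c]. *)
Lemma smooth_on_transition_diff c d (W : set M) (v : 'rV[R]_m -> 'rV[R]_m) :
  atlas c -> atlas d -> open W -> W `<=` chart_dom c ->
  smooth_on (c @` chart_dom c) v ->
  smooth_on (d @` (chart_dom d `&` W))
    (fun x => transition_diff c d (chart_inv d x) (v (c (chart_inv d x)))).
Proof.
move=> ac ad oW Wc vS k.
have oU := @open_chart_image d W oW.
have oU' := @open_chart_image c (chart_dom d) (@chart_open_dom _ _ _ d).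
have tS := transition_smooth ac ad.
have sS : Ck_on k (d @` (chart_dom d `&` W)) (c \o chart_inv d).
  apply: Ck_on_subset (transition_smooth ad ac k) => _ [p [dp Wp] <-].
  by exists p => //; split=> //; apply: Wc.
apply: Ck_on_row => // j.
pose f y := \sum_l v y 0 l * 'D_(delta_mx 0 l) (d \o chart_inv c) y 0 j.
apply: (@Ck_on_eq _ _ _ _ _ (fun x => f ((c \o chart_inv d) x)) _ oU) => [|].
  move=> _ [p [dp Wp] <-] /=; rewrite chart_mapK//.
  have cp := Wc _ Wp; have tD := differentiable_transition ac ad cp dp.
  rewrite /transition_diff -deriveE// derive_rowE// summxE.
  by apply: eq_bigr => l _; rewrite !mxE.
apply: (@Ck_on_comp _ _ _ _ _ (c @` (chart_dom c `&` chart_dom d))) => //.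
  move=> _ [p [dp Wp] <-] /=; rewrite chart_mapK//.
  by exists p => //; split=> //; apply: Wc.
apply: Ck_on_sum => // l _; apply: Ck_onM => //; apply: Ck_on_coord => //.
  by apply: Ck_on_subset (vS k) => _ [p [cp _] <-]; exists p.
by have [_] := tS k.+1; apply.
Qed.

End Charts.

(** * The eigenbundles are smooth *)

Section Eigenbundle.
Variables (R : realType) (m : nat) (M : smoothManifold R m).
Variables (g : forall p : M, {symmetric (tangent p)}).
Variables (w : forall p : M, {skew_symmetric (tangent p)}).
Variables (A : forall p : M, 'End(tangent p)).
Hypotheses (gS : smooth_form g) (gN : forall p, nondegenerate (g p)).
Hypothesis (wS : smooth_form w).
Hypothesis gA : forall p (X Y : tangent p), g p (A p X) Y = w p X Y.
Hypothesis AA : forall p (X : tangent p), A p (A p X) = X.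
Local Open Scope classical_set_scope.

Let N (a : R) (c : chart R m M) (x : 'rV[R]_m) : 'M[R]_m :=
  scaled_eigenproj_mx a (chart_gram g c x) (chart_gram w c x).

Let N_smooth a c k : atlas c ->
  forall i j, Ck_on k (c @` chart_dom c) (fun x => N a c x i j).
Proof.
move=> ac; apply: Ck_on_scaled_eigenproj_mx; first exact: chart_open_img.
  move=> i j; under eq_fun do rewrite mxE.
  exact: gS.
move=> i j; under eq_fun do rewrite mxE.
exact: wS.
Qed.

Let N_frame a c p u : atlas c -> chart_dom c p ->
  chart_frame c p (u *m N a c (c p)) =
  \det (chart_gram g c (c p)) *:
    (chart_frame c p u + a *: A p (chart_frame c p u)).
Proof.
move=> ac cp; rewrite /N !chart_gramE//.
exact: (@scaled_eigenproj_mxE _ _ _ _ (chart_frame_surj ac cp) _ _ _ a u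
         (@gA p) (gN p)).
Qed.

(** The frame near [p0]: extend a basis of the eigenspace at [p0] with constant
    components in a chart, and project to the eigenspace at each point. *)
Lemma eigenbundle_subbundle (a : R) (k : nat) :
  a * a = 1 -> (forall p, \dim (eigenbundle A a p) = k) ->
  subbundle (eigenbundle A a).
Proof.
move=> aa dimL; exists k => p0.
have dimL0 := dimL p0; subst k; set k := \dim _ in dimL *.
set c := chart_at p0; have ac : atlas c := atlas_chart_at p0.
have cp0 : chart_dom c p0 := chart_at_dom p0.
have frame0 u : chart_frame c p0 u = u by apply: transition_diff_id.
pose V : 'M[R]_(k, m) := \matrix_(i < k) (vbasis (eigenbundle A a p0))`_i.
have V_free : row_free V.
  rewrite -kermx_eq0; apply/rowV0P => u /sub_kermxP.
  rewrite mulmx_sum_row => u0.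
  have /andP[_ /freeP Lfree] := vbasisP (eigenbundle A a p0).
  apply/rowP => i; rewrite mxE; apply: (Lfree (fun i => u 0 i)).
  by rewrite -[RHS]u0; apply: eq_bigr => l _; rewrite rowK.
pose X (i : 'I_k) (q : M) : tangent q :=
  chart_frame c q (row i V *m N a c (c q)).
(* At [p0] the projection fixes the rows of [V], so that [pinvmx V] is there a
   right inverse up to a scalar: a nonzero [D] at a point makes the projected
   vectors independent there, and [D] is nonzero at [p0]. *)
pose D x := \det (V *m N a c x *m pinvmx V).
pose W := [set q | chart_dom c q /\ D (c q) != 0].
have Wc : W `<=` chart_dom c by move=> q [].
have Dcont q : chart_dom c q -> {for c q, continuous D}.
  move=> cq; have oU := @chart_open_img _ _ _ c.
  have DC : Ck_on 0 (c @` chart_dom c) D.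
    apply: Ck_on_det => // i j; apply: Ck_on_mulmx => // i' j'.
      apply: Ck_on_mulmx => // i'' j''; first exact: Ck_on_cst.
      exact: N_smooth.
    exact: Ck_on_cst.
  by apply: DC; exists q.
have oW : open W.
  rewrite openE => q [cq Dq].
  have : \forall q' \near q, D (c q') != 0.
    have cvgD : {for q, continuous (D \o c)}.
      apply: continuous_comp; first exact: chart_map_continuous.
      exact: Dcont.
    exact: cvgr_neq0 cvgD Dq.
  have : \forall q' \near q, chart_dom c q'.
    by apply: open_nbhs_nbhs; split; first exact: chart_open_dom.
  by apply: filterS2 => q' cq' Dq'; split.
have VN0 : V *m N a c (c p0) = (2 * \det (chart_gram g c (c p0))) *: V.
  apply/row_matrixP => i; rewrite row_mul linearZ /= rowK.
  set u := _`_i; have : (u : tangent p0) \in eigenbundle A a p0.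
    by rewrite vbasis_mem// mem_nth// size_tuple.
  rewrite mem_leigenspace => /eqP Au.
  have := N_frame a u ac cp0; rewrite !frame0 => ->.
  rewrite Au [a *: (a *: u)]scalerA aa scale1r.
  by rewrite -[u + u]mulr2n -[u *+ 2]scaler_nat scalerA mulrC.
have Wp0 : W p0.
  split=> //; rewrite /D VN0 -scalemxAl mulmxVp// detZ det1 mulr1.
  rewrite expf_neq0// mulf_neq0 ?pnatr_eq0//.
  rewrite chart_gramE//.
  exact: det_gram_neq0 (chart_frame_inj ac cp0) (chart_frame_surj ac cp0)
                       _ _ (gN p0).
exists W, X; split=> //.
- move=> i d ad.
  have vS : smooth_on (c @` chart_dom c) (fun x => row i V *m N a c x).
    move=> l; apply: Ck_on_row; first exact: chart_open_img.
    move=> j; apply: Ck_on_mulmx => [|i' j'|i' j'].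
    - exact: chart_open_img.
    - exact: Ck_on_cst.
    - exact: N_smooth.
  have := smooth_on_transition_diff ac ad oW Wc vS.
  move=> S l; apply: Ck_on_eq (S l); first exact: open_chart_image.
  (* Stated at [q] and not at [chart_inv d (d q)], on which the type of the
     tangent vector would depend. *)
  have coordE q : chart_dom d q -> W q ->
      transition_diff c d q (row i V *m N a c (c q)) = tangent_coord d (X i q).
    by move=> dq Wq; apply/esym/tangent_coord_frame => //; apply: Wc.
  by move=> _ [q [dq Wq] <-]; apply: coordE; rewrite (chart_mapK dq).
- move=> q [cq Dq].
  have XL i : X i q \in eigenbundle A a q.
    rewrite /X N_frame//.
    exact: (mem_eigenproj_scaled (@AA q) _ _ aa).
  have Xfree : free [seq X i q | i : 'I_k].
    change (free (mktuple (X^~ q))); apply/freeP => b.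
    under eq_bigr do rewrite nth_mktuple -linearZ.
    rewrite -linear_sum -[RHS](linear0 (chart_frame c q)).
    move=> /(chart_frame_inj ac cq).
    under eq_bigr do rewrite scalemxAl.
    rewrite -mulmx_suml.
    have -> : \sum_i b i *: row i V = (\row_i b i) *m V.
      by rewrite mulmx_sum_row; apply: eq_bigr => i _; rewrite mxE.
    move=> /(congr1 (mulmx^~ (pinvmx V))); rewrite mul0mx -!mulmxA.
    set S := V *m _ => b0.
    have Su : S \in unitmx by rewrite /S mulmxA unitmxE unitfE.
    move: b0 => /(congr1 (mulmx^~ (invmx S))); rewrite mulmxK// mul0mx.
    by move=> /rowP b0 i; have := b0 i; rewrite !mxE.
  rewrite basisEfree Xfree size_map size_enum_ord dimL leqnn andbT.
  by apply/span_subvP => _ /mapP[i _ ->].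
Qed.

End Eigenbundle.

(** * Born structures *)

Lemma nondegenerate_recursion_unique (R : realFieldType) (vT : vectType R)
    (g : {symmetric vT}) (A A' : 'End(vT)) :
  nondegenerate g -> (forall X Y, g (A X) Y = g (A' X) Y) -> A = A'.
Proof.
move=> gN AA'; apply/lfunP => X; apply/subr0_eq/(nondegenerate_eq0 gN) => Y.
by rewrite linearBl /= AA' subrr.
Qed.

Theorem proposition12 (R : realType) (m : nat) (M : smoothManifold R m)
    (g h : forall p : M, {symmetric (tangent p)})
    (w : forall p : M, {skew_symmetric (tangent p)})
    (A B J : forall p : M, 'End(tangent p)) :
  born_structure g h w ->
  recursion_operators g h w A B J ->
  [/\ lagrangian w (eigenbundle A 1),
      lagrangian w (eigenbundle A (- 1)),
      almost_kunneth w (eigenbundle A 1) (eigenbundle A (- 1)) &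
      forall (p : M) (X Y : tangent p),
        g p X Y = neutral_metric w (eigenbundle A 1) (eigenbundle A (- 1)) X Y].
Proof.
move=> [[gS gN] _ [wS wN] [A' [B' [J' [[gA' _ _] AA']]]]] [gA _ _].
(* The Born structure comes with some recursion operators that are involutions;
   non-degeneracy of [g] identifies them with the given ones. *)
have AA p (X : tangent p) : A p (A p X) = X.
  have -> : A p = A' p.
    by apply: (nondegenerate_recursion_unique (gN p)) => Y Z; rewrite gA gA'.
  by have [+ _ _] := AA' p; move=> /lfunP/(_ X); rewrite comp_lfunE id_lfunE.
have N11 : (- 1) * (- 1) = 1 :> R by rewrite mulrNN mulr1.
have sub a : a = 1 \/ a = - 1 -> subbundle (eigenbundle A a).
  move=> a1; have aa : a * a = 1 by case: a1 => ->; rewrite ?mulr1.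
  apply: (@eigenbundle_subbundle _ _ _ g w A gS gN wS gA AA a (m./2) aa) => p.
  rewrite (dim_eigenspace (AA p) (gA p) (wN p))//.
  by rewrite dimvf /dim /= mul1n.
have iso a : isotropic w (eigenbundle A a).
  by move=> p; apply: eigenspace_isotropic (gA p) a.
have [sub1 subN1] := (sub 1 (or_introl erefl), sub (- 1) (or_intror erefl)).
split.
- split=> [|p]; first exact: sub1.
  exact: orthov_eigenspace (@AA p) _ _ (gA p) (wN p) _ (mulr1 1).
- split=> [|p]; first exact: subN1.
  exact: orthov_eigenspace (@AA p) _ _ (gA p) (wN p) _ N11.
- split; [by split | exact: sub1 | exact: subN1 | | exact: iso | exact: iso].
  move=> p; split; first exact: eigenspace_add (@AA p).
  exact: eigenspace_cap.
move=> p X Y; rewrite -{1}(AA p X) gA /neutral_metric; congr (w p _ Y).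
have L1 := mem_eigenproj (AA p) X (mulr1 1).
have LN1 := mem_eigenproj (AA p) X N11.
rewrite -{2}(eigenprojD (A p) 1 X).
rewrite (almost_productE (eigenspace_cap _) L1 LN1).
move: L1 LN1; rewrite !mem_leigenspace => /eqP AL1 /eqP ALN1.
rewrite -{1}(eigenprojD (A p) 1 X) linearD /= AL1 ALN1.
by rewrite scale1r scaleN1r.
Qed.
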